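(* Let $n,k$ be natural numbers with $n\ge2$ and let $\mathcal{A}\subseteq[k]^n$ be a transitive-symmetric vector-intersecting family. If $2\log n\le k\le\sqrt n\log n$, then $\frac{|\mathcal{A}|}{k^n}\le128\exp\left(-\frac{0.0001k}{\log n}\right)$. If $k>\sqrt n\log n$, then $\frac{|\mathcal{A}|}{k^n}\le128\exp(-0.0001\sqrt n)$.
   Context: $\log$ natural. $\mathcal{A}\subseteq[k]^n$ is vector-intersecting if for all $x,y\in\mathcal{A}$ there is $i\in[n]$ with $x_i=y_i$. It is transitive-symmetric if for all $i,j\in[n]$ there is a permutation $\sigma$ of $[n]$ with $\sigma(i)=j$ such that $(x_1,\dots,x_n)\in\mathcal{A}\iff(x_{\sigma(1)},\dots,x_{\sigma(n)})\in\mathcal{A}$. *)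

(* Defs.v *)
From mathcomp Require Import all_boot all_fingroup.
From Stdlib Require Import Reals.
Set Implicit Arguments. Unset Strict Implicit. Unset Printing Implicit Defensive.

Definition vector_intersecting (n k : nat) (A : {set {ffun 'I_n -> 'I_k}}) : Prop :=
  forall x y, x \in A -> y \in A -> exists i : 'I_n, x i = y i.

Definition transitive_symmetric (n k : nat) (A : {set {ffun 'I_n -> 'I_k}}) : Prop :=
  forall i j : 'I_n, exists sigma : {perm 'I_n},
    sigma i = j /\
    forall x : {ffun 'I_n -> 'I_k},
      x \in A <-> [ffun t => x (sigma t)] \in A.

(* Main.v *)
Require Import Defs.
From mathcomp Require Import all_boot all_fingroup zify.
From Stdlib Require Import ZArith Reals Lra.
Import ssrnat.

(** Identify a vector x with its graph in [n] * [k], put r = k / 2, and choose a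
partial vector X maximising |A(X)| r^|X|, where A(X) is the set of members of A
extending X. Then |A| 2^|X| <= k^n, and every further set S of entries is
contained in at most |A(X)| / r^|S| members of A(X). If |X|^2 < n, transitivity
gives an automorphism sigma moving X off itself. Colour [n] * [k] uniformly with
2L = O(log n) colours. By the spread lemma it is likely that some member of A(X)
uses, outside X, only the first L colours, and likewise that some member of
A(sigma X) uses, outside sigma X, only the last L colours; moreover the former
can be chosen to avoid sigma X and the latter to avoid X. These two vectors agree nowhere, a
contradiction. Hence |X| is at least of order min(k, sqrt n).

The spread lemma is proved by minimal fragments, as in Park and Pham's proof of
the Kahn-Kalai conjecture: each new colour class at least halves the part of most
members that is still uncovered. *)

Set Implicit Arguments.
Unset Strict Implicit.
Unset Printing Implicit Defensive.

Lemma card_bigcup_le (I T : finType) (P : pred I) (F : I -> {set T}) :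
  #|\bigcup_(i | P i) F i| <= \sum_(i | P i) #|F i|.
Proof.
elim/big_rec2: _ => [|i s U _ le]; first by rewrite cards0.
by apply: leq_trans (leq_card_setU _ _) _; rewrite leq_add2l.
Qed.

Lemma leq_exp_base m n e : m <= n -> m ^ e <= n ^ e.
Proof. by case: e => // e; rewrite leq_exp2r. Qed.

(** * Minimal fragments and the spread lemma *)

Section Fragments.

Variables (T X : finType) (B : {set X}).
Implicit Types (G : X -> {set T}) (W : {set T}).

Definition active m G x := (x \in B) && (#|G x| < m).

(* The uncovered part [G y :\: W] of least size among the small [G y] contained
   in [W :|: G x]. *)
Definition fragment m G W x : {set T} :=
  if active m G x then
    G [arg min_(y < x | active m G y && (G y :\: W \subset G x)) #|G y :\: W|] :\: W
  else G x.

Lemma fragment_inactive m G W x : ~~ active m G x -> fragment m G W x = G x.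
Proof. by rewrite /fragment => /negbTE->. Qed.

(** The last clause drives the decoding: a small [G y] inside [W] and the fragment is itself a
    candidate of the [arg min], so its uncovered part, lying in the fragment, must equal it. *)
Lemma fragmentP m G W x : active m G x ->
  [/\ fragment m G W x \subset G x,
      exists2 y, active m G y & fragment m G W x = G y :\: W
    & forall y, active m G y -> G y \subset W :|: fragment m G W x ->
        fragment m G W x \subset G y].
Proof.
move=> ax; rewrite /fragment ax.
case: arg_minnP => [|y /andP[ay sy] miny]; first by rewrite ax subsetDl.
split=> //; first by exists y.
move=> z az sz; have sz' : G z :\: W \subset G y :\: W by rewrite subDset.
have /eqP<- : G z :\: W == G y :\: W.
  by rewrite eqEcard sz' miny // az (subset_trans sz' sy).
exact: subsetDl.
Qed.

Lemma fragment_sub m G W x : fragment m G W x \subset G x.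
Proof.
case: (boolP (active m G x)) => [/(fragmentP W)[]//|/fragment_inactive->//].
Qed.

Variables (F : X -> {set T}) (L : nat).

(** The size threshold starts at [2 ^ L] and halves at each stage; an element whose set is not below
    it is frozen. *)
Fixpoint state (Ws : nat -> {set T}) j : X -> {set T} :=
  if j is i.+1 then fragment (2 ^ (L - i)) (state Ws i) (Ws i) else F.

Lemma state_local Ws Ws' j : (forall i, i < j -> Ws i = Ws' i) ->
  state Ws j = state Ws' j.
Proof.
elim: j => //= j IHj eqW; rewrite IHj ?eqW // => i lt_ij.
by apply: eqW; rewrite ltnW.
Qed.

Lemma state_sub Ws j x : state Ws j x \subset F x.
Proof.
elim: j => //= j; apply: subset_trans; exact: fragment_sub.
Qed.

Lemma active_pred Ws j x : active (2 ^ (L - j.+1)) (state Ws j.+1) x ->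
  active (2 ^ (L - j)) (state Ws j) x.
Proof.
apply: contraLR => nax; rewrite /active /= fragment_inactive //.
apply: contra nax => /andP[xB lt]; rewrite /active xB /=.
by apply: leq_trans lt _; rewrite leq_exp2l //; lia.
Qed.

(** Frozen elements stay frozen, so the fragments of an active element compose. At [j = L] the
    threshold is 1, which forces the left side to be empty and [F y] to be covered. *)
Lemma active_state Ws j x : active (2 ^ (L - j)) (state Ws j) x ->
  exists2 y, y \in B & state Ws j x = F y :\: \bigcup_(i < j) Ws i.
Proof.
elim: j x => [|j IHj] x; first by case/andP=> xB _; exists x; rewrite // big_ord0 setD0.
move/active_pred => /(fragmentP (Ws j))[_ [y ay eq_y] _].
have [z zB eq_z] := IHj y ay; exists z => //=.
by rewrite eq_y eq_z big_ord_recr /= setDDl.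
Qed.

End Fragments.

Definition colour_class (T : finType) q (chi : {ffun T -> 'I_q}) (i : nat) : {set T} :=
  [set t | chi t == i :> nat].

Lemma card_agree_off (T : finType) q (chi : {ffun T -> 'I_q}) (S : {set T}) :
  #|[set f : {ffun T -> 'I_q} | [forall t, (t \notin S) ==> (f t == chi t)]]|
    = q ^ #|S|.
Proof.
pose Q t := if t \in S then [pred c : 'I_q | true] else pred1 (chi t).
have -> : #|[set f : {ffun T -> 'I_q} | [forall t, (t \notin S) ==> (f t == chi t)]]|
   = #|finfun.family Q|.
  apply: eq_card => f; rewrite inE.
  apply/forallP/familyP => h t; have := h t; rewrite /Q; case: (t \in S) => //.
rewrite card_family foldrE big_image /= (bigID (mem S)) /=.
rewrite [X in _ * X]big1 ?muln1; last first.
  by move=> t /negbTE tS; rewrite /Q tS card1.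
rewrite (eq_bigr (fun=> q)) ?prod_nat_const // => t tS.
by rewrite /Q tS -[RHS]card_ord; apply: eq_card.
Qed.

Section Spread.

Variables (T X : finType) (B : {set X}) (F : X -> {set T}) (L q N : nat).
Hypothesis spread : forall S : {set T},
  #|[set x in B | S \subset F x]| * (32 * q) ^ #|S| <= N.

Let G (chi : {ffun T -> 'I_q}) := state B F L (colour_class chi).

Definition stuck j : {set {ffun T -> 'I_q} * X} :=
  [set p | active B (2 ^ (L - j)) (G p.1 j) p.2 &&
           ~~ active B (2 ^ (L - j.+1)) (G p.1 j.+1) p.2].

(* Encoding: recolour the fragment S of a stuck pair (chi, x) with the colour j.
   From the new colouring one reads off a small set R containing S (minimality of
   the fragment), so there are at most 2^|R| choices for S; then chi is lost only
   on S, and x only among the members containing S. *)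
Lemma card_stuck j : j < L -> L <= q ->
  #|stuck j| * 8 ^ (2 ^ (L - j.+1)) <= #|{ffun T -> 'I_q}| * N.
Proof.
move=> ltjL leLq.
have ltjq : j < q by apply: leq_trans leLq.
pose cj := Ordinal ltjq.
set t0 := 2 ^ (L - j.+1); pose m := 2 ^ (L - j).
have m_t0 : m = t0.*2 by rewrite /m /t0 -mul2n -expnS; congr (_ ^ _); lia.
pose recol (chi : {ffun T -> 'I_q}) (S : {set T}) : {ffun T -> 'I_q} :=
  [ffun t => if t \in S then cj else chi t].
pose frag (p : {ffun T -> 'I_q} * X) := G p.1 j.+1 p.2.
pose h p := (recol p.1 (frag p), frag p).
pose R (chi : {ffun T -> 'I_q}) : {set T} :=
  if [pick y | active B m (G chi j) y && (G chi j y \subset colour_class chi j)]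
  is Some y then G chi j y else set0.
pose P (p : {ffun T -> 'I_q} * {set T}) := (p.2 \subset R p.1) && (t0 <= #|p.2|).
have hP p : p \in stuck j -> P (h p).
  case: p => chi x; rewrite inE /= => /andP[ax nax].
  rewrite /P /=; set S := frag (chi, x).
  have xB : x \in B by case/andP: ax.
  have leS : t0 <= #|S|.
    by move: nax; rewrite /active xB /= -leqNgt.
  rewrite leS andbT.
  have [subS [y ay eqy] minS] := fragmentP (colour_class chi j) ax.
  rewrite -/m -/(G chi j) in ay eqy minS subS.
  have eqS : fragment B m (G chi j) (colour_class chi j) x = S by [].
  rewrite eqS in eqy minS subS.
  set chi' := recol chi S.
  have [z zB eqz] := active_state ax.
  (* Recolouring thus only moves points of colour above [j] into class [j]; the classes below [j],
     and with them stage [j], are unchanged. *)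
  have Sj t : t \in S -> j < chi t.
    move=> tS; have : t \in G chi j x by apply: (subsetP subS).
    rewrite /G eqz inE => /andP[tU _].
    have : t \notin colour_class chi j by move: tS; rewrite eqy inE => /andP[].
    rewrite inE => ntj; rewrite ltn_neqAle eq_sym ntj /= leqNgt.
    apply/negP => lt; case/negP: tU; apply/bigcupP; exists (Ordinal lt) => //.
    by rewrite inE.
  have eqG : G chi' j = G chi j.
    apply: state_local => i ltij; apply/setP => t; rewrite !inE ffunE.
    case: ifP => // tS; have := Sj t tS => /= lt.
    by rewrite !gtn_eqF //; apply: ltn_trans lt.
  have eqW : colour_class chi' j = colour_class chi j :|: S.
    apply/setP => t; rewrite !inE ffunE; case: ifP => _; rewrite ?orbT ?orbF //.
    by rewrite eqxx.
  rewrite /R eqG; case: pickP => [y'' /andP[ay'' sy'']|/(_ y)].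
    by apply: minS => //; rewrite -eqW.
  by rewrite ay /= eqW eqy -subDset subxx.
(* In the spread bound [q ^ #|S|] pays for the colours lost on [S], which leaves [32 ^ #|S|]. *)
have fibre p : P p -> #|[set d in stuck j | h d == p]| * 32 ^ t0 <= N.
  case: p => chi' S /andP[/= _ leS].
  apply: leq_trans (spread S).
  rewrite expnMn mulnA mulnAC.
  apply: leq_mul; last by rewrite leq_exp2l.
  rewrite -(card_agree_off chi') mulnC -cardsX.
  apply: subset_leq_card; apply/subsetP => -[chi x]; rewrite !inE /=.
  case/andP=> [/andP[/andP[xB _] _]] /eqP[<- <-]; rewrite xB /= state_sub andbT.
  by apply/forallP => t; rewrite ffunE; apply/implyP => /negbTE->.
(* As [R] has fewer than [m = 2 * t0] points, choosing [S] costs less than [4 ^ t0]; of [32 ^ t0]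
   there remains [8 ^ t0]. *)
have le32 : #|stuck j| * 32 ^ t0 <= #|{ffun T -> 'I_q}| * (2 ^ m.-1 * N).
  rewrite -sum1_card (partition_big h P) //= big_distrl /=.
  apply: (@leq_trans (\sum_(p | P p) N)).
    apply: leq_sum => p Pp; apply: leq_trans (fibre p Pp).
    rewrite leq_mul2r -sum1_card; apply/orP; right; apply: eq_leq.
    by apply: eq_bigl => d; rewrite !inE.
  rewrite (eq_bigl (fun p => predT p.1 && P (p.1, p.2))); last by case.
  rewrite -(pair_big_dep predT (fun chi S => P (chi, S)) (fun _ _ => N)) /=.
  rewrite -sum_nat_const; apply: leq_sum => chi _.
  rewrite sum_nat_const leq_mul2r; apply/orP; right.
  apply: (@leq_trans #|powerset (R chi)|).
    by apply: subset_leq_card; apply/subsetP => S; rewrite powersetE => /andP[].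
  rewrite card_powerset leq_exp2l // /R; case: pickP => [y /andP[/andP[_ lt] _]|_].
    by rewrite -ltnS prednK // m_t0 double_gt0 expn_gt0.
  by rewrite cards0.
have pos4 : 0 < 4 ^ t0 by rewrite expn_gt0.
rewrite -(leq_pmul2r pos4) -mulnA -expnMn; apply: leq_trans le32 _.
rewrite -!mulnA leq_mul2l; apply/orP; right.
rewrite mulnC leq_mul2l; apply/orP; right.
by rewrite -[4]/(2 ^ 2) -expnM leq_exp2l // m_t0 mul2n leq_pred.
Qed.

(** The powers 1/8, 1/64, ... sum to at most 1/7; the extra [M] in [key] is the slack that closes
    the induction. *)
Lemma geometric_tail (a : nat -> nat) M :
  (forall j, j < L -> a j * 8 ^ (L - j) <= M) -> 7 * \sum_(j < L) a j <= M.
Proof.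
move=> ha.
have pos8 : 0 < 8 ^ L by rewrite expn_gt0.
have key l : l <= L -> 7 * (\sum_(j < l) a j) * 8 ^ L + M <= M * 8 ^ l.
  elim: l => [|l IHl] ltlL; first by rewrite big_ord0 muln0 mul0n muln1.
  have := IHl (ltnW ltlL).
  have : a l * 8 ^ L <= M * 8 ^ l.
    by rewrite -(subnK (ltnW ltlL)) expnD mulnA leq_mul2r ha ?orbT.
  by rewrite big_ord_recr /= expnS; lia.
rewrite -(leq_pmul2r pos8); apply: leq_trans (key L (leqnn L)); exact: leq_addr.
Qed.

(* Unless some [F x] lies in the first [L] colour classes, every [x] in [B] gets
   stuck at one of the [L] stages. *)
Lemma spread_cover : 0 < N -> N <= 2 * #|B| -> L <= q ->
  (forall x, x \in B -> #|F x| < 2 ^ L) ->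
  7 * #|[set chi : {ffun T -> 'I_q} |
          ~~ [exists x in B, F x \subset [set t | chi t < L]]]|
    <= 2 * #|{ffun T -> 'I_q}|.
Proof.
move=> N0 leN leLq ltF; set fail := [set chi | _].
have sub : setX fail B \subset \bigcup_(j < L) stuck j.
  apply/subsetP => -[chi x] /setXP[/=]; rewrite inE => /existsPn nchi xB.
  apply/bigcupP.
  have a0 : active B (2 ^ (L - 0)) (G chi 0) x by rewrite /active xB subn0 ltF.
  have aL : ~~ active B (2 ^ (L - L)) (G chi L) x.
    apply/negP => aL; have [y yB eqy] := active_state aL.
    case/negP: (nchi y); rewrite yB /=.
    have : G chi L x = set0.
      by move: aL; rewrite /active subnn ltnS leqn0 cards_eq0 => /andP[_ /eqP].
    rewrite /G eqy => /eqP; rewrite setD_eq0 => /subset_trans; apply.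
    apply/bigcupsP => i _; apply/subsetP => t; rewrite !inE => /eqP->.
    exact: ltn_ord.
  have ex : exists j, ~~ active B (2 ^ (L - j)) (G chi j) x by exists L.
  case: (ex_minnP ex) => -[|j] nj minj; first by rewrite a0 in nj.
  have ltj : j < L by apply: minj aL.
  exists (Ordinal ltj) => //; rewrite inE /= nj andbT.
  by apply: contraT => /minj; rewrite ltnn.
have le_sum : #|fail| * #|B| <= \sum_(j < L) #|stuck j|.
  rewrite -cardsX; apply: leq_trans (subset_leq_card sub) _.
  exact: card_bigcup_le.
have le7 : 7 * \sum_(j < L) #|stuck j| <= #|{ffun T -> 'I_q}| * N.
  (* The doubly exponential gain is weakened to a geometric one by [l + 1 <= 2 ^ l]. *)
  apply: (geometric_tail (a := fun j => #|stuck j|)) => j ltj.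
  apply: leq_trans (card_stuck ltj leLq); rewrite leq_mul2l leq_exp2l //.
  apply/orP; right; have -> : L - j = (L - j.+1).+1 by lia.
  exact: ltn_expl.
rewrite -(leq_pmul2r N0).
move: le_sum le7 leN; set s := \sum_(j < L) _; nia.
Qed.

End Spread.


(** * Automorphisms *)

Section Automorphisms.

Variables (n k : nat) (A : {set {ffun 'I_n -> 'I_k}}).
Implicit Types (x : {ffun 'I_n -> 'I_k}) (s : {perm 'I_n}).

Definition reindex s x : {ffun 'I_n -> 'I_k} := [ffun t => x (s t)].

Definition automorphisms : {set {perm 'I_n}} :=
  [set s | [forall x, (reindex s x \in A) == (x \in A)]].

Lemma mem_reindex s x : s \in automorphisms -> (reindex s x \in A) = (x \in A).
Proof. by rewrite inE => /forallP/(_ x)/eqP. Qed.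

Lemma automorphismsM s t : s \in automorphisms -> t \in automorphisms ->
  (s * t)%g \in automorphisms.
Proof.
move=> sG tG; rewrite inE; apply/forallP => x.
have -> : reindex (s * t)%g x = reindex s (reindex t x).
  by apply/ffunP => i; rewrite !ffunE permM.
by rewrite !mem_reindex.
Qed.

Lemma automorphisms1 : 1%g \in automorphisms.
Proof.
rewrite inE; apply/forallP => x.
by rewrite (_ : reindex 1%g x = x) //; apply/ffunP => i; rewrite !ffunE perm1.
Qed.

Hypothesis trA : transitive_symmetric A.

Lemma transitive_automorphism i j : exists2 s, s \in automorphisms & s i = j.
Proof.
have [s [sij sA]] := trA i j; exists s => //.
by rewrite inE; apply/forallP => x; apply/eqP; apply/idP/idP => /(sA x).
Qed.

(** Right multiplication by an automorphism taking [j] to [l] injects this fibre of [s i] into the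
    fibre over [l], for each of the [n] values [l]. *)
Lemma card_automorphisms_at i j :
  n * #|[set s in automorphisms | s i == j]| <= #|automorphisms|.
Proof.
rewrite -[leqRHS]sum1_card (partition_big (fun s : {perm 'I_n} => s i) predT) //=.
rewrite -[X in X * _]card_ord -sum_nat_const; apply: leq_sum => l _.
have [t tG tjl] := transitive_automorphism j l.
rewrite sum1_card -(card_imset _ (mulIg t)); apply: subset_leq_card.
apply/subsetP => _ /imsetP[s /[!inE] /andP[sG /eqP sij] ->].
by rewrite unfold_in /= permM sij tjl eqxx andbT automorphismsM // inE.
Qed.

Definition shift s (t : 'I_n * 'I_k) : 'I_n * 'I_k := (s t.1, t.2).

Lemma shiftK s : cancel (shift s) (shift s^-1%g).
Proof. by case=> i a; rewrite /shift /= permK. Qed.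

Lemma shiftKV s : cancel (shift s^-1%g) (shift s).
Proof. by case=> i a; rewrite /shift /= permKV. Qed.

(* Averaging over the automorphism group: a pair of points of [S] is matched
   by a fraction 1/n of the group. *)
Lemma disjoint_shift (S : {set 'I_n * 'I_k}) : #|S| ^ 2 < n ->
  exists2 s, s \in automorphisms & [disjoint S & shift s @: S].
Proof.
move=> ltSn; pose hit (p : ('I_n * 'I_k) * ('I_n * 'I_k)) :=
  [set s in automorphisms | s p.1.1 == p.2.1].
have card_hits : n * #|\bigcup_(p in setX S S) hit p| <= #|S| ^ 2 * #|automorphisms|.
  apply: (@leq_trans (n * \sum_(p in setX S S) #|hit p|)).
    by rewrite leq_mul2l card_bigcup_le orbT.
  rewrite big_distrr /= -mulnn -cardsX -sum_nat_const; apply: leq_sum => p _.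
  exact: card_automorphisms_at.
have pos : 0 < #|automorphisms| by apply/card_gt0P; exists 1%g; exact: automorphisms1.
have /subsetPn[s sG nhit] : ~~ (automorphisms \subset \bigcup_(p in setX S S) hit p).
  apply/negP => /subset_leq_card le.
  have : n * #|automorphisms| <= #|S| ^ 2 * #|automorphisms|.
    by apply: leq_trans card_hits; rewrite leq_mul2l le orbT.
  by rewrite leq_pmul2r // leqNgt ltSn.
exists s => //; rewrite disjoints_subset; apply/subsetP => u uS; rewrite inE.
apply/imsetP => -[t tS eq_u]; case/negP: nhit; apply/bigcupP.
by exists (t, u); [rewrite in_setX /= tS | rewrite inE sG eq_u /=].
Qed.

End Automorphisms.

(** * Intersecting families *)

Section Intersecting.

Variables (n k : nat).
Implicit Types (x : {ffun 'I_n -> 'I_k}) (A : {set {ffun 'I_n -> 'I_k}}).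
Implicit Types (S : {set 'I_n * 'I_k}).

Definition graph x : {set 'I_n * 'I_k} := [set t | x t.1 == t.2].

Lemma card_graph x : #|graph x| = n.
Proof.
have -> : graph x = [set (i, x i) | i : 'I_n].
  apply/setP => -[i a]; rewrite inE /=; apply/eqP/imsetP => [<-|[j _ [-> ->]]] //.
  by exists i.
by rewrite card_imset ?card_ord // => i j [].
Qed.

Definition link A S := [set x in A | S \subset graph x].

(** If the link is nonempty, [S] lies in a graph, so it fixes [#|S|] distinct coordinates. *)
Lemma card_link A S : #|link A S| * k ^ #|S| <= k ^ n.
Proof.
have [->|[x0]] := set_0Vmem (link A S); first by rewrite cards0.
rewrite inE => /andP[_ Sx0].
pose D := [set t.1 | t in S].
have cardD : #|D| = #|S|.
  apply: card_in_imset => -[i a] [j b] /(subsetP Sx0) + /(subsetP Sx0).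
  by rewrite !inE /= => /eqP <- /eqP <- ->.
have sub : link A S \subset
    [set f : {ffun 'I_n -> 'I_k} | [forall t, (t \notin ~: D) ==> (f t == x0 t)]].
  apply/subsetP => x; rewrite !inE => /andP[_ Sx]; apply/forallP => i.
  rewrite inE negbK; apply/implyP => /imsetP[[j a] tS ->] /=.
  move: (subsetP Sx _ tS) (subsetP Sx0 _ tS); rewrite !inE /= => /eqP-> /eqP->.
  by [].
apply: (@leq_trans (k ^ #|~: D| * k ^ #|S|)).
  by rewrite leq_mul2r -(card_agree_off x0) (subset_leq_card sub) orbT.
by rewrite -expnD addnC -cardD cardsC card_ord.
Qed.

Variables (A : {set {ffun 'I_n -> 'I_k}}) (r : nat) (X : {set 'I_n * 'I_k}).
Hypothesis r_gt0 : 0 < r.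
Hypothesis maxX : forall S, #|link A S| * r ^ #|S| <= #|link A X| * r ^ #|X|.

(** For [S] disjoint from [X], compare the weights of [S :|: X] and [X]; otherwise no member
    qualifies. *)
Lemma link_spread S :
  #|[set x in link A X | S \subset graph x :\: X]| * r ^ #|S| <= #|link A X|.
Proof.
have [disj|ndisj] := boolP [disjoint S & X]; last first.
  rewrite (_ : [set x in _ | _] = set0) ?cards0 //; apply/setP => x; rewrite !inE.
  by apply/negbTE; apply: contra ndisj; rewrite subsetD => /andP[_ /andP[]].
have posX : 0 < r ^ #|X| by rewrite expn_gt0 r_gt0.
rewrite -(leq_pmul2r posX) -mulnA -expnD.
have -> : #|S| + #|X| = #|S :|: X|.
  by rewrite cardsU (_ : S :&: X = set0) ?cards0 ?subn0 //; apply/eqP; rewrite setI_eq0.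
apply: leq_trans (maxX (S :|: X)); rewrite leq_mul2r; apply/orP; right.
apply: subset_leq_card; apply/subsetP => x; rewrite !inE subUset subsetD.
by case/andP=> /andP[-> ->] /andP[->].
Qed.

(** By spreadness each point of [Y] lies in at most a fraction [1/r] of the link; a union bound
    discards at most half. *)
Lemma link_avoiding (Y : {set 'I_n * 'I_k}) : [disjoint X & Y] -> 2 * #|Y| <= r ->
  #|link A X| <= 2 * #|[set x in link A X | [disjoint graph x & Y]]|.
Proof.
move=> disj leYr; set B := [set x in _ | _].
have le : #|link A X| <= #|B| +
    \sum_(t in Y) #|[set x in link A X | [set t] \subset graph x :\: X]|.
  apply: (@leq_trans #|B :|:
     \bigcup_(t in Y) [set x in link A X | [set t] \subset graph x :\: X]|).
    apply: subset_leq_card; apply/subsetP => x xX; rewrite !inE in xX *.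
    case: (boolP [disjoint _ & Y]) => [_|/pred0Pn[t /andP[/= tx tY]]]; rewrite xX //=.
    apply/bigcupP; exists t => //; rewrite !inE xX /= sub1set inE tx andbT.
    by rewrite (disjointFl disj).
  apply: leq_trans (leq_card_setU _ _) _; rewrite leq_add2l.
  exact: card_bigcup_le.
have : (\sum_(t in Y) #|[set x in link A X | [set t] \subset graph x :\: X]|) * r
    <= #|Y| * #|link A X|.
  rewrite big_distrl -sum_nat_const /=; apply: leq_sum => t _.
  by have := link_spread [set t]; rewrite cards1 expn1.
move: le; move: (\sum_(t in Y) _) => u; nia.
Qed.

Lemma link_cover L (Y : {set 'I_n * 'I_k}) : n < 2 ^ L -> 64 * L <= r ->
    0 < #|link A X| -> [disjoint X & Y] -> 2 * #|Y| <= r ->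
  7 * #|[set chi : {ffun 'I_n * 'I_k -> 'I_(2 * L)} |
          ~~ [exists x in [set x in link A X | [disjoint graph x & Y]],
               graph x :\: X \subset [set t | chi t < L]]]|
    <= 2 * #|{ffun 'I_n * 'I_k -> 'I_(2 * L)}|.
Proof.
move=> ltnL leLr N0 disj leY.
apply: (@spread_cover _ _ _ (fun x => graph x :\: X) L _ #|link A X|) => //.
- move=> S; apply: leq_trans (link_spread S); apply: leq_mul.
    by apply: subset_leq_card; apply/subsetP => x; rewrite !inE => /andP[/andP[-> _] ->].
  by rewrite leq_exp_base //; lia.
- exact: link_avoiding.
- by rewrite leq_pmull.
- move=> x _; apply: leq_ltn_trans ltnL; rewrite -[leqRHS](card_graph x).
  by rewrite subset_leq_card // subsetDl.
Qed.

End Intersecting.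

Lemma intersecting_card (n k L d : nat) (A : {set {ffun 'I_n -> 'I_k}}) :
    vector_intersecting A -> transitive_symmetric A ->
    n < 2 ^ L -> 64 * L <= k %/ 2 -> 0 < L -> d ^ 2 < n -> 2 * d <= k %/ 2 ->
  #|A| * 2 ^ d.+1 <= k ^ n.
Proof.
move=> intA trA ltnL leLk L0 ltdn ledk.
set r := k %/ 2 in leLk ledk.
have r0 : 0 < r by lia.
have [->|A0] := eqVneq A set0; first by rewrite cards0.
case: (@arg_maxnP _ set0 predT (fun S => #|link A S| * r ^ #|S|) isT) => X _ maxX.
have {}maxX S : #|link A S| * r ^ #|S| <= #|link A X| * r ^ #|X| by exact: maxX.
have linkA : link A set0 = A by apply/setP => x; rewrite !inE sub0set andbT.
have leA : #|A| <= #|link A X| * r ^ #|X|.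
  by have := maxX set0; rewrite cards0 muln1 linkA.
have N0 : 0 < #|link A X|.
  by rewrite lt0n; apply: contraNneq A0 => eq0; rewrite -cards_eq0 -leqn0 -[0](mul0n (r ^ #|X|)) -eq0.
have leA2 : #|A| * 2 ^ #|X| <= k ^ n.
  apply: leq_trans (card_link A X).
  apply: (@leq_trans (#|link A X| * r ^ #|X| * 2 ^ #|X|)); first by rewrite leq_mul2r leA orbT.
  rewrite -mulnA -expnMn leq_mul2l; apply/orP; right.
  by apply: leq_exp_base; rewrite /r; lia.
case: (ltnP d #|X|) => [ltdX|leXd].
  by apply: leq_trans leA2; rewrite leq_mul2l leq_exp2l // ltdX orbT.
exfalso.
have ltXn : #|X| ^ 2 < n by apply: leq_ltn_trans ltdn; rewrite leq_exp2r.
have [s sG disj1] := disjoint_shift trA ltXn.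
have inj_shift t : injective (@shift n k t) by apply: can_inj (@shiftK n k t).
have disj2 : [disjoint X & shift s^-1%g @: X].
  rewrite disjoints_subset; apply/subsetP => u uX; rewrite inE; apply/imsetP => -[t tX eq_u].
  have := disjointFr disj1 tX; rewrite -[t](@shiftKV n k s) -eq_u.
  by rewrite (imset_f (shift s) uX).
have leY t : 2 * #|shift t @: X| <= r.
  by rewrite card_imset //; apply: leq_trans ledk; rewrite leq_mul2l leXd orbT.
have c1 := link_cover r0 maxX ltnL leLk N0 disj2 (leY _).
have c2 := link_cover r0 maxX ltnL leLk N0 disj1 (leY _).
set fail1 := [set chi : {ffun 'I_n * 'I_k -> 'I_(2 * L)} | _] in c1.
set fail2 := [set chi : {ffun 'I_n * 'I_k -> 'I_(2 * L)} | _] in c2.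
(* Both vectors are sought in [link A X]: the second one for the colouring transported by [s] with
   colours reversed, and then pulled back by [reindex s]. Since [Phi] is injective, each failure has
   probability at most 2/7. *)
pose Phi (chi : {ffun 'I_n * 'I_k -> 'I_(2 * L)}) : {ffun 'I_n * 'I_k -> 'I_(2 * L)} :=
  [ffun t => rev_ord (chi (shift s^-1%g t))].
have injPhi : injective Phi.
  move=> f g eqfg; apply/ffunP => t; have := congr1 (fun h : {ffun _} => h (shift s t)) eqfg.
  by rewrite !ffunE shiftK => /rev_ord_inj.
have lt_all : #|fail1 :|: Phi @^-1: fail2| < #|{ffun 'I_n * 'I_k -> 'I_(2 * L)}|.
  apply: leq_ltn_trans (leq_card_setU _ _) _.
  rewrite card_preimset //.
  have : 0 < #|{ffun 'I_n * 'I_k -> 'I_(2 * L)}|.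
    have L2 : 0 < 2 * L by lia.
    by apply/card_gt0P; exists [ffun=> Ordinal L2].
  by lia.
have [chi] : exists chi, chi \notin fail1 :|: Phi @^-1: fail2.
  apply/existsP; apply: contraTT lt_all; rewrite negb_exists => /forallP all.
  by rewrite -leqNgt; apply: subset_leq_card; apply/subsetP => chi _; have := all chi; rewrite negbK.
rewrite !inE negb_or !negbK => /andP[/existsP[x /andP[xB cx]] /existsP[y /andP[yB cy]]].
move: xB yB; rewrite !inE => /andP[/andP[xA Xx] dx] /andP[/andP[yA Xy] dy].
have yA' : reindex s y \in A by rewrite mem_reindex.
have [i] := intA _ _ xA yA'; rewrite ffunE => eqi.
pose t : 'I_n * 'I_k := (i, x i).
have tx : t \in graph x by rewrite inE.
have ty : shift s t \in graph y by rewrite inE /= eqi.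
(* An agreement at [t] in [X] would put [shift s t] in [shift s @: X], which [y] avoids; the other
   case is symmetric. *)
have tX : t \notin X.
  by apply/negP => tX; have := disjointFr dy ty; rewrite imset_f.
have stX : shift s t \notin X.
  by apply/negP => stX; have := disjointFr dx tx; rewrite -[t](@shiftK n k s) imset_f.
have : t \in graph x :\: X by rewrite in_setD tX.
move/(subsetP cx); rewrite inE => lt1.
have : shift s t \in graph y :\: X by rewrite in_setD stX.
move/(subsetP cy); rewrite inE ffunE shiftK /=; move: lt1 L0.
move: (nat_of_ord _) => c; clear; lia.
Qed.

(** * Real estimates *)

Lemma INR_expn k n : INR (k ^ n)%N = (INR k ^ n)%R.
Proof. by elim: n => // n IHn; rewrite expnS -multE mult_INR IHn. Qed.

Lemma INR_floor (x : R) : (0 <= x)%R -> exists d : nat, (INR d <= x < INR d + 1)%R.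
Proof.
move=> x0; have [le gt] := base_Int_part x.
have Z0 : (0 <= Int_part x)%Z.
  by apply Z.lt_succ_r, lt_IZR; rewrite succ_IZR; lra.
by exists (Z.to_nat (Int_part x)); rewrite INR_IZR_INZ Z2Nat.id //; lra.
Qed.

Lemma ln_le x y : (0 < x)%R -> (x <= y)%R -> (ln x <= ln y)%R.
Proof.
move=> x0 [lt|->]; [by left; apply: ln_increasing | exact: Rle_refl].
Qed.

Lemma exp_le x y : (x <= y)%R -> (exp x <= exp y)%R.
Proof. by case=> [/exp_increasing/Rlt_le|->]; [|exact: Rle_refl]. Qed.

Lemma trunc_log_ln n : (2 <= n)%N -> (INR (trunc_log 2 n).+1 <= 4 * ln (INR n))%R.
Proof.
move=> n2; have n2R : (2 <= INR n)%R by apply: (le_INR 2); apply/leP.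
have ln2 := ln_lt_2.
have lnn : (ln 2 <= ln (INR n))%R by apply: ln_le; lra.
have : (INR (trunc_log 2 n) * ln 2 <= ln (INR n))%R.
  rewrite -ln_pow; last lra.
  apply: ln_le; first by apply: pow_lt; lra.
  rewrite -[2%R]/(INR 2) -INR_expn; apply: le_INR; apply/leP.
  by apply: trunc_logP => //; apply: ltnW.
have := pos_INR (trunc_log 2 n); rewrite S_INR; nra.
Qed.

(** Serves both ranges of [k], with [z] equal to [k / ln n] or to [sqrt n]. *)
Lemma intersecting_density (n k : nat) (A : {set {ffun 'I_n -> 'I_k}}) (z : R) :
    (2 <= n)%N -> vector_intersecting A -> transitive_symmetric A ->
    (0 <= z <= sqrt (INR n))%R -> (z * ln (INR n) <= INR k)%R ->
  (INR #|A| / INR k ^ n <= 128 * exp (- (1 / 10000 * z)))%R.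
Proof.
move=> n2 intA trA [z0 zn] zk.
have leA : #|A| <= k ^ n.
  by apply: leq_trans (max_card _) _; rewrite card_ffun !card_ord.
(* For [k = 0] the denominator is 0, but the numerator vanishes too, so the quotient is 0. *)
have [k0|k_gt0] := posnP k.
  have -> : #|A| = 0.
    by apply/eqP; rewrite -leqn0 (leq_trans leA) // k0 exp0n // (leq_trans _ n2).
  by have := exp_pos (- (1 / 10000 * z))%R; rewrite /Rdiv Rmult_0_l; lra.
have kR : (0 < INR k ^ n)%R by apply: pow_lt; apply: lt_0_INR; apply/ltP.
suff : (INR #|A| <= 128 * exp (- (1 / 10000 * z)) * INR k ^ n)%R.
  by move=> le; apply: (Rmult_le_reg_r (INR k ^ n)) => //; rewrite /Rdiv Rmult_assoc Rinv_l ?Rmult_1_r //; lra.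
have leAR : (INR #|A| <= INR k ^ n)%R by rewrite -INR_expn; apply: le_INR; apply/leP.
(* For small [z] the bound is trivial, since [128 / e] exceeds 1. *)
have [zle|zgt] := Rle_lt_dec z 10000.
  have e1 : (exp (- (1)) <= exp (- (1 / 10000 * z)))%R by apply: exp_le; lra.
  have : (exp (- (1)) * exp 1 = 1)%R by rewrite -exp_plus Rplus_opp_l exp_0.
  have := exp_le_3; have := exp_pos (- (1))%R.
  move: (exp (- (1))) (exp 1) e1 => a b e1 a0 b3 ab.
  have : (1 <= 128 * a)%R by nra.
  have : (0 < INR k ^ n)%R by []; nra.
have n2R : (2 <= INR n)%R by apply: (le_INR 2); apply/leP.
have ln2 := ln_lt_2.
have lnn : (ln 2 <= ln (INR n))%R by apply: ln_le; lra.
(* As [ln 2 > 1/2], this [d] gives [2 ^ d.+1 >= exp (z / 10000)]. *)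
have [d [dle dgt]] : exists d : nat, (INR d <= z / 5000 < INR d + 1)%R.
  by apply: INR_floor; lra.
have zln : (10000 * ln (INR n) <= z * ln (INR n))%R by nra.
have zln2 : (z / 2 <= z * ln (INR n))%R by nra.
pose L := (trunc_log 2 n).+1.
have LR : (INR L <= 4 * ln (INR n))%R := trunc_log_ln n2.
have Lk : 128 * L <= k.
  apply/leP; apply: INR_le; rewrite -multE mult_INR.
  have -> : INR 128 = 128%R by rewrite INR_IZR_INZ.
  lra.
have dn : d ^ 2 < n.
  apply/ltP; apply: INR_lt; rewrite INR_expn /= Rmult_1_r.
  have := sqrt_sqrt (INR n); have := pos_INR d; nra.
have dk : 4 * d <= k.
  apply/leP; apply: INR_le; rewrite -multE mult_INR.
  have -> : INR 4 = 4%R by rewrite INR_IZR_INZ.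
  lra.
have /leP/le_INR : #|A| * 2 ^ d.+1 <= k ^ n.
  by apply: (intersecting_card (L := L)) => //; [exact: trunc_log_ltn | lia | lia].
rewrite -multE mult_INR !INR_expn [INR 2]/(2%R) => le.
have exp2 : (1 <= 2 ^ d.+1 * exp (- (1 / 10000 * z)))%R.
  have p2 : (0 < 2)%R by lra.
  rewrite -Rpower_pow // /Rpower -exp_plus S_INR.
  apply: Rle_trans (exp_ineq1_le _); nra.
have := exp_pos (- (1 / 10000 * z))%R; have := pos_INR #|A|.
move: (exp _) (2 ^ d.+1)%R exp2 le => e p exp2 le A0 e0.
have le1 : (INR #|A| * 1 <= INR #|A| * (p * e))%R by apply: Rmult_le_compat_l.
have le2 := Rmult_le_compat_r _ _ _ (Rlt_le _ _ e0) le.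
have : (0 < e * INR k ^ n)%R by apply: Rmult_lt_0_compat.
lra.
Qed.

Theorem mainTheorem15 (n k : nat) (A : {set {ffun 'I_n -> 'I_k}}) :
  (2 <= n)%N ->
  vector_intersecting A ->
  transitive_symmetric A ->
  ((2 * ln (INR n) <= INR k <= sqrt (INR n) * ln (INR n))%R ->
     (INR #|A| / (INR k ^ n) <= 128 * exp (- ((1 / 10000) * INR k / ln (INR n))))%R)
  /\
  ((sqrt (INR n) * ln (INR n) < INR k)%R ->
     (INR #|A| / (INR k ^ n) <= 128 * exp (- ((1 / 10000) * sqrt (INR n))))%R).
Proof.
move=> n2 intA trA.
have n2R : (2 <= INR n)%R by apply: (le_INR 2); apply/leP.
have lnn : (0 < ln (INR n))%R by rewrite -ln_1; apply: ln_increasing; lra.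
split=> [[_ kle]|klt]; last first.
  by apply: intersecting_density => //; [split; [exact: sqrt_pos | lra] | lra].
have eqk : (INR k / ln (INR n) * ln (INR n) = INR k)%R by field; lra.
rewrite [(_ * INR k / _)%R]Rmult_assoc; apply: intersecting_density => //; last first.
  by rewrite -/(Rdiv _ _) eqk; lra.
rewrite -/(Rdiv _ _); split; apply: (Rmult_le_reg_r (ln (INR n))) => //; rewrite eqk //.
by rewrite Rmult_0_l; exact: pos_INR.
Qed.
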